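(* Let $(E,d)$ be a metric space with its Borel $\sigma$-algebra, let $p\ge 1$, and let $(\mu_n)_{n\in\mathbb{N}}\subset\mathcal{P}_p(E)$ be a sequence of probability measures with finite $p$-th moment that converges to $\mu\in\mathcal{P}(E)$ in the Hilbert projective metric, i.e. $\mathcal{H}(\mu_n,\mu)\to 0$. Then also $\mathcal{W}_p(\mu_n,\mu)\to 0$ as $n\to\infty$.
   Context: $\mathcal{P}(E)$ is the set of Borel probability measures on $E$, and $\mathcal{P}_p(E)$ the set of those $\mu\in\mathcal{P}(E)$ with $\int_E d(x_0,x)^p\,d\mu(x)<\infty$ for some (equivalently every) $x_0\in E$. $\mathcal{W}_p(\mu,\nu)=\big(\inf_\pi\int_{E\times E}d(x,y)^p\,d\pi(x,y)\big)^{1/p}$ is the $p$-Wasserstein distance, where $\pi$ ranges over probability measures on $E\times E$ with marginals $\mu$ and $\nu$. The Hilbert projective metric is $\mathcal{H}(\mu,\nu)=\log\big(\beta(\mu,\nu)\beta(\nu,\mu)\big)\in[0,\infty]$, where $\beta(\mu,\nu)=\inf\{r>0: r\mu-\nu \text{ is a non-negative measure}\}$ with $\inf\emptyset=\infty$; equivalently $\mathcal{H}(\mu,\nu)=\log\big(\|\tfrac{d\mu}{d\nu}\|_\infty\|\tfrac{d\nu}{d\mu}\|_\infty\big)$ if $\mu\sim\nu$ with essentially bounded densities, and $\infty$ otherwise. *)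

(* Defs.v *)
From HB Require Import structures.
From mathcomp Require Import all_boot all_order all_algebra.
From mathcomp Require Import all_classical all_reals all_analysis.

Set Implicit Arguments.
Unset Strict Implicit.
Unset Printing Implicit Defensive.

Import Order.TTheory GRing.Theory Num.Theory.
Import numFieldNormedType.Exports.

Local Open Scope classical_set_scope.
Local Open Scope ring_scope.

(* [measurableType] requires a point. This excludes only the empty metric
   space, which carries no probability measure. *)
#[short(type="pmetricType")]
HB.structure Definition PMetric (K : numDomainType) :=
  { M of Pointed M & Metric K M }.

(* For non-separable [E] the Borel sigma-algebra of [E * E], written
   [borel (E * E)%type], may be strictly larger than the product
   sigma-algebra that [measurable] denotes on [borel E * borel E]; the distance
   is always measurable for the former. *)
Notation borel T := (g_sigma_algebraType (@open T)).

Section wasserstein.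
Context {R : realType} {E : pmetricType R}.
Implicit Types (p : R) (mu nu : probability (borel E) R).
Local Open Scope ereal_scope.

Definition finite_moment p mu : Prop :=
  exists x0 : E, \int[mu]_x ((mdist x0 (x : E) `^ p)%R)%:E < +oo.

(* Values of a measure on non-measurable sets are meaningless, so marginals are
   compared on measurable sets only. *)
Definition couplings mu nu : set (probability (borel (E * E)%type) R) :=
  [set pi : probability (borel (E * E)%type) R |
     forall A : set (borel E), measurable A ->
       pushforward pi (fst : borel (E * E)%type -> borel E) A = mu A /\
       pushforward pi (snd : borel (E * E)%type -> borel E) A = nu A].

Definition wasserstein p mu nu : \bar R :=
  (ereal_inf [set \int[pi]_z ((mdist (z : E * E).1 z.2 `^ p)%R)%:E
             | pi in couplings mu nu]) `^ (p^-1)%R.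

End wasserstein.

Section hilbert_metric.
Context d {T : measurableType d} {R : realType}.
Implicit Types (mu nu : probability T R).
Local Open Scope ereal_scope.

Definition hilbert_beta mu nu : \bar R :=
  ereal_inf [set r%:E | r in [set r : R | (0 < r)%R /\
    forall A : set T, measurable A -> 0 <= r%:E * mu A - nu A]].

Definition hilbert_metric mu nu : \bar R :=
  lne (hilbert_beta mu nu * hilbert_beta nu mu).

End hilbert_metric.

(* Main.v *)
From HB Require Import structures.
Require Import Defs.
From mathcomp Require Import all_boot all_order all_algebra.
From mathcomp Require Import all_classical all_reals all_analysis.
From mathcomp Require Import measurable_realfun lra.
Import Order.TTheory GRing.Theory Num.Theory.
Import numFieldNormedType.Exports.
Local Open Scope classical_set_scope.
Local Open Scope ring_scope.

Set Implicit Arguments.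
Unset Strict Implicit.

(* If the Hilbert distance between [nu] and [mu] is less than [ln s], then
   [nu <= s mu] and [mu <= s nu]. The residual [alpha = nu - mu / s] is then a
   measure with [alpha <= (s - 1/s) mu], and leaving the mass [mu / s] in place
   while coupling [alpha] independently with [mu] gives a coupling of [nu] and
   [mu]. Both marginals of its off-diagonal part are at most [(s - 1/s) mu], and
   [d(x, y)^p <= 2^p (d(x0, x)^p + d(x0, y)^p)], so its cost is at most
   [2^(p+1) (s - 1/s)] times the [p]-th moment of [mu]. That moment is finite
   because [mu <= 2 mu_N] for some [N], and [s - 1/s] tends to [0] as [s] tends
   to [1]. *)

(** * Borel measurability from generators, and continuity of the distance *)

Lemma measurable_fun_superlevel (R : realType) (T : pointedType)
    (G : set (set T)) (f : T -> \bar R) :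
  (forall a : R, G [set x | (a%:E < f x)%E]) ->
  measurable_fun [set: g_sigma_algebraType G] f.
Proof.
move=> fG; apply: (measurability _ (ErealGenOInfty.measurableE R)).
move=> _ [_ [a ->]] <-; rewrite setTI preimage_itvoy.
exact: sub_sigma_algebra.
Qed.

Lemma measurable_fun_g_sigma (S T : pointedType) (G : set (set S))
    (H : set (set T)) (f : S -> T) :
  (forall B, H B -> G (f @^-1` B)) ->
  measurable_fun [set: g_sigma_algebraType G]
    (f : g_sigma_algebraType G -> g_sigma_algebraType H).
Proof.
move=> fGH; pose T' := g_sigma_algebraType H.
apply: (@measurability _ _ (g_sigma_algebraType G) T' setT f H erefl).
move=> _ [B HB <-]; rewrite setTI.
by apply: sub_sigma_algebra; exact: fGH.
Qed.

(** By the triangle inequality the distance changes by at most [d(x, x') + d(y, y')], so [e / 2] in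
    each coordinate suffices. *)
Lemma mdist_continuous (R : realType) (E : pmetricType R) :
  continuous (fun z : E * E => mdist z.1 z.2).
Proof.
move=> [x y] /=; apply/cvgrPdist_lt => e e0.
have e20 : 0 < e / 2 by rewrite divr_gt0.
have : \forall z \near nbhs (x, y), ball x (e / 2) z.1 /\ ball y (e / 2) z.2.
  by exists (ball x (e / 2), ball y (e / 2)) => //=; split; exact: nbhsx_ballx.
apply: filterS => -[x' y'] /=; rewrite !ballEmdist/= => -[xx' yy'].
have := metric_triangle x x' y; have := metric_triangle x' y' y.
have := metric_triangle x' x y'; have := metric_triangle x y y'.
rewrite (metric_sym y' y) (metric_sym x' x) => *.
rewrite ltr_norml; apply/andP; split; lra.
Qed.

(** * Product measures on the Borel sets of a product of metric spaces *)

Section borel_product.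
Local Open Scope ereal_scope.
Context {R : realType} {E F : pmetricType R}.
Variable b : {finite_measure set (borel F) -> \bar R}.
Implicit Type A : set (borel (E * F)%type).

Lemma measurable_xsection_borel A (x : E) :
  measurable A -> measurable (xsection A x : set (borel F)).
Proof.
move=> mA; have cx : continuous (pair x : F -> (E * F)%type).
  by move=> y; apply: cvg_pair => //=; exact: cvg_cst.
have xo (B : set (E * F)) : open B -> open (pair x @^-1` B : set F).
  by move/continuousP : cx; exact.
have := measurable_fun_g_sigma xo measurableT mA.
by rewrite setTI xsectionE.
Qed.

Let section_measure A : borel E -> \bar R := fun x => b (xsection A x).

(* Countably many thickened sections [U k] exhaust [xsection A x], and [U k] is
   contained in [xsection A z] for every [z] in the ball of radius [1/(k+1)]. *)
Lemma open_xsection_measure A (a : R) :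
  open (A : set (E * F)) -> open [set x : E | a%:E < b (xsection A x)].
Proof.
move=> oA; rewrite openE => x /= ax.
(* Without the interior this is an intersection of possibly uncountably many sections; the interior
   makes it Borel. *)
pose U (k : nat) : set F :=
  [set y | [set z | ball x k.+1%:R^-1%R z] `*` [set y] `<=` A]^°.
have mU k : measurable (U k : set (borel F)).
  by apply: sub_sigma_algebra; exact: open_interior.
have UA : \bigcup_k U k = xsection A x.
  apply/seteqP; split => y.
    move=> [k _ /interior_subset/=]; rewrite /xsection/= => h.
    by apply/mem_set/h; split => //=; exact: ballxx.
  rewrite /xsection/= => /set_mem Axy.
  have [[P Q] /= [/nbhs_ballP[e /= e0 eP] yQ] PQA] : nbhs (x, y) A.
    by rewrite openE in oA; exact: oA.
  (* With [k] the integer part of [1 / e], one has [1 / (k + 1) <= e]. *)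
  exists (Num.truncn e^-1) => //; rewrite /U/=.
  apply: filterS yQ => y' Qy' [z w]/= [xz ->]; apply: PQA; split => //=.
  apply: eP; apply: le_ball xz.
  by rewrite invf_ple ?posrE// ltW// truncnS_gt.
have ndU : {homo U : m n / (m <= n)%N >-> (m <= n)%O}.
  move=> m n mn; apply/subsetPset; apply: interiorS => y /= h [z w] /= [xz ->].
  apply: h; split => //=; apply: le_ball xz.
  by rewrite lef_pV2 ?posrE// ler_nat.
have := nondecreasing_cvg_mu (mu := b) mU (bigcupT_measurable _ mU) ndU.
rewrite UA => bU.
have [k ak] : exists k, a%:E < b (U k).
  apply: contrapT => /forallNP aU; move: ax; apply/negP; rewrite -leNgt.
  by apply: (cvge_to_le bU); apply: nearW => k; rewrite leNgt; apply/negP/aU.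
apply: filterS (nbhsx_ballx x k.+1%:R^-1%R _) => //= z xz.
apply: (lt_le_trans ak); apply: le_measure.
- by rewrite inE.
- by rewrite inE; by apply: measurable_xsection_borel; exact: sub_sigma_algebra.
- move=> y /interior_subset /= h; rewrite /xsection/=; apply/mem_set/h.
  by split.
Qed.

(** Dynkin's argument, started from the open sets, where the section measure is lower
    semicontinuous. Complements rely on [b] being finite, and disjoint unions give series of
    nonnegative measurable functions. *)
Lemma measurable_fun_xsection_borel A :
  measurable A -> measurable_fun setT (section_measure A).
Proof.
move: A; apply: (@dynkin_induction _ (borel (E * F)%type) open
  (fun A => measurable_fun setT (section_measure A)) erefl).
- exact: openI.
- apply: (eq_measurable_fun (cst (b setT))); last exact: measurable_cst.
  by move=> x _; rewrite /section_measure xsectionE preimage_setT.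
- move=> G oG; apply: measurable_fun_superlevel => a.
  exact: open_xsection_measure.
- move=> S mS mbS.
  apply: (eq_measurable_fun (fun x => b setT - section_measure S x)).
    move=> x _; rewrite /section_measure.
    have -> : xsection (~` S) x = setT `\` xsection S x.
      by rewrite !xsectionE setTD.
    rewrite measureD ?setTI//; first exact: measurable_xsection_borel.
    by rewrite ltey_eq fin_num_measure.
  by apply: emeasurable_funB => //; exact: measurable_cst.
- move=> G mG tG mbG.
  apply: (eq_measurable_fun
    (fun x => \sum_(0 <= k <oo) section_measure (G k) x)).
    move=> x _; rewrite /section_measure xsection_bigcup.
    rewrite measure_bigcup//.
    + by apply: eq_eseriesl => k; rewrite in_setT.
    + by move=> k _; exact: measurable_xsection_borel.
    + exact: trivIset_xsection.
  by apply: ge0_emeasurable_sum => // k x _ _; exact: measure_ge0.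
Qed.

Variable a : {measure set (borel E) -> \bar R}.

(* The product sigma-algebra may miss open sets of [E * F] when the spaces are
   not separable, so the product measure of the library is not enough: this is
   its extension to all Borel sets of [E * F]. *)
Definition borel_product A : \bar R := \int[a]_x b (xsection A x).

Let borel_product0 : borel_product set0 = 0.
Proof.
by rewrite /borel_product integral0_eq// => x _; rewrite xsection0 measure0.
Qed.

Let borel_product_ge0 A : 0 <= borel_product A.
Proof. by apply: integral_ge0 => x _; exact: measure_ge0. Qed.

Let borel_product_sigma_additive : semi_sigma_additive borel_product.
Proof.
move=> G mG tG mUG.
have -> : borel_product (\bigcup_n G n) = \sum_(n <oo) borel_product (G n).
  rewrite /borel_product -integral_nneseries//.
  - apply: eq_integral => x _; rewrite xsection_bigcup measure_bigcup//.
    + by apply: eq_eseriesl => k; rewrite in_setT.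
    + by move=> k _; exact: measurable_xsection_borel.
    + exact: trivIset_xsection.
  - by move=> k; exact: measurable_fun_xsection_borel.
by apply: is_cvg_nneseries => k _ _; exact: borel_product_ge0.
Qed.

HB.instance Definition _ := isMeasure.Build _ _ _ borel_product
  borel_product0 borel_product_ge0 borel_product_sigma_additive.

Lemma borel_product_fst (A : set (borel E)) : measurable A ->
  borel_product (fst @^-1` A) = a A * b setT.
Proof.
move=> mA; rewrite /borel_product.
(* The section at [x] is everything if [x] lies in [A], and empty otherwise. *)
transitivity (\int[a]_x (b setT * (\1_A x)%:E)).
  apply: eq_integral => x _; rewrite xsectionE indicE.
  have [/set_mem xA|/negP xA] := boolP (x \in A).
    by rewrite mule1; congr (b _); apply/seteqP; split.
  rewrite mule0 -(measure0 b); congr (b _); apply/seteqP; split => // y /= xA'.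
  exact/xA/mem_set.
rewrite ge0_integralZl//; first by rewrite integral_indic// setIT muleC.
exact/measurable_EFinP.
Qed.

Lemma borel_product_snd (B : set (borel F)) : measurable B ->
  borel_product (snd @^-1` B) = a setT * b B.
Proof.
move=> mB; rewrite /borel_product.
transitivity (\int[a]_x (cst (b B) x)).
  by apply: eq_integral => x _; rewrite xsectionE; congr (b _).
by rewrite integral_cst// muleC.
Qed.

End borel_product.

(** * Powers of the distance *)

Section mdist_powR.
Context {R : realType} {E : pmetricType R} (p : R).

Lemma measurable_mdist_powR :
  measurable_fun [set: borel (E * E)%type]
    (fun z : E * E => ((mdist z.1 z.2 `^ p)%R)%:E).
Proof.
apply/measurable_EFinP.
apply: (measurableT_comp (@measurable_powR R p)).
apply/measurable_EFinP; apply: measurable_fun_superlevel => a.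
have /continuousP := @mdist_continuous R E.
by move=> /(_ [set r | a < r]); apply; exact: open_gt.
Qed.

Lemma measurable_mdistr_powR (x0 : E) :
  measurable_fun [set: borel E] (fun x : E => ((mdist x0 x `^ p)%R)%:E).
Proof.
have cx0 : continuous (pair x0 : E -> (E * E)%type).
  by move=> y; apply: cvg_pair => //=; exact: cvg_cst.
have ox0 (B : set (E * E)) : open B -> open (pair x0 @^-1` B : set E).
  by move/continuousP : cx0; exact.
exact: (measurableT_comp measurable_mdist_powR (measurable_fun_g_sigma ox0)).
Qed.

(** [d(x, y)] is at most twice the larger distance to [x0], and the [p]-th power of a maximum is one
    of the two powers, hence at most their sum. *)
Lemma mdist_powR_le (x0 x y : E) : 0 <= p ->
  mdist x y `^ p <= 2 `^ p * (mdist x0 x `^ p + mdist x0 y `^ p).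
Proof.
move=> p0; pose m := Num.max (mdist x0 x) (mdist x0 y).
have m0 : 0 <= m by rewrite le_max mdist_ge0.
apply: (@le_trans _ _ ((2 * m) `^ p)).
  apply: ge0_ler_powR; rewrite ?nnegrE ?mdist_ge0 ?mulr_ge0//.
  apply: (le_trans (metric_triangle x x0 y)).
  rewrite (metric_sym x) mulrDl mul1r.
  by apply: lerD; rewrite le_max lexx ?orbT.
rewrite powRM// ler_wpM2l ?powR_ge0//.
rewrite /m; case: (leP (mdist x0 x)) => _; [rewrite lerDr|rewrite lerDl];
  exact: powR_ge0.
Qed.

End mdist_powR.

(** * Difference of two finite measures *)

Section measure_difference.
Local Open Scope ereal_scope.
Context d (T : measurableType d) (R : realType).
Variables m1 m2 : {finite_measure set T -> \bar R}.

(* Truncated at [0] because a measure has to be nonnegative on non-measurable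
   sets too. *)
Definition measure_sub (A : set T) : \bar R := maxe 0 (m1 A - m2 A).

Hypothesis m21 : forall A, measurable A -> m2 A <= m1 A.

Lemma measure_subE A : measurable A -> measure_sub A = m1 A - m2 A.
Proof.
by move=> mA; rewrite /measure_sub max_r// sube_ge0 ?m21// fin_num_measure.
Qed.

Let measure_sub0 : measure_sub set0 = 0.
Proof. by rewrite measure_subE// !measure0 sube0. Qed.

Let measure_sub_ge0 A : 0 <= measure_sub A.
Proof. by rewrite /measure_sub le_max lexx. Qed.

Let measure_sub_sigma_additive : semi_sigma_additive measure_sub.
Proof.
move=> F mF tF mUF; rewrite measure_subE//.
rewrite [X in X @ _ --> _](_ : _ = (fun n => \sum_(0 <= i < n) m1 (F i)
    - \sum_(0 <= i < n) m2 (F i))); last first.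
  apply/funext => n; under eq_bigr do rewrite measure_subE//.
  rewrite big_split/= sumeN// => i j _ _.
  by rewrite fin_num_adde_defl// fin_num_measure.
(* Both measures are finite, so the difference of the limits is not of the form [oo - oo]. *)
apply: cvgeB; last 2 first.
- exact: measure_semi_sigma_additive.
- exact: measure_semi_sigma_additive.
by rewrite fin_num_adde_defr// fin_num_measure.
Qed.

HB.instance Definition _ := isMeasure.Build _ _ _ measure_sub
  measure_sub0 measure_sub_ge0 measure_sub_sigma_additive.

Lemma measure_sub_exists : exists m : {measure set T -> \bar R},
  forall A, measurable A -> m A = m1 A - m2 A.
Proof. by exists measure_sub; exact: measure_subE. Qed.

End measure_difference.

(** * Maps to and from the product space, and image measures *)

Section diagonal.
Context {R : realType} {E : pmetricType R}.

(** Bundled below as a measurable function, so that its [distribution] under [mu] can represent mass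
    left in place. *)
Definition diag (x : borel E) : borel (E * E)%type := (x : E, x : E).

Let measurable_diag : measurable_fun setT diag.
Proof.
have cdiag : continuous (fun x : E => (x, x)).
  by move=> y; apply: cvg_pair => //=; exact: cvg_id.
have odiag (B : set (E * E)) :
    open B -> open ((fun x : E => (x, x)) @^-1` B).
  by move/continuousP : cdiag; exact.
exact: (measurable_fun_g_sigma odiag).
Qed.

HB.instance Definition _ := isMeasurableFun.Build _ _ _ _ diag measurable_diag.

End diagonal.

Section borel_projections.
Context {R : realType} {E : pmetricType R}.

Lemma measurable_fst_borel : measurable_fun [set: borel (E * E)%type]
  (fst : borel (E * E)%type -> borel E).
Proof.
have ofst (B : set E) : open B -> open (fst @^-1` B : set (E * E)).
  by apply: (iffLR (continuousP _)) => z; exact: cvg_fst.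
exact: (measurable_fun_g_sigma ofst).
Qed.

Lemma measurable_snd_borel : measurable_fun [set: borel (E * E)%type]
  (snd : borel (E * E)%type -> borel E).
Proof.
have osnd (B : set E) : open B -> open (snd @^-1` B : set (E * E)).
  by apply: (iffLR (continuousP _)) => z; exact: cvg_snd.
exact: (measurable_fun_g_sigma osnd).
Qed.

End borel_projections.

(** A change of variables gives an integral against the image of [Q], which is dominated by [c m].
    With [phi] a projection this bounds a cost through a marginal; with the identity it carries
    moments from one measure to another. *)
Lemma ge0_integral_comp_le d1 d2 (X : measurableType d1) (Y : measurableType d2)
    (R : realType) (phi : X -> Y) (Q : {measure set X -> \bar R})
    (m : {measure set Y -> \bar R}) (c : {nonneg R}) (f : Y -> \bar R) :
  measurable_fun setT phi -> measurable_fun setT f ->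
  (forall y, (0 <= f y)%E) ->
  (forall A, measurable A -> (Q (phi @^-1` A) <= c%:num%:E * m A)%E) ->
  (\int[Q]_x f (phi x) <= c%:num%:E * \int[m]_y f y)%E.
Proof.
move=> mphi mf f0 Qm; rewrite -ge0_integral_mscale//.
have -> : (\int[Q]_x f (phi x) = \int[pushforward Q phi]_y f y)%E.
  by rewrite ge0_integral_pushforward.
by apply: ge0_le_measure_integral.
Qed.

Section probability_of_measure.
Context d (T : measurableType d) (R : realType).
Variables (m : {measure set T -> \bar R}) (mT : m setT = 1%E).

(** Another name for [m], on which the instances depending on [mT] can be declared. *)
Let q : set T -> \bar R := m.

HB.instance Definition _ := isMeasure.Build _ _ _ q
  (measure0 m) (measure_ge0 m) (@measure_semi_sigma_additive _ _ _ m).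

HB.instance Definition _ := Measure_isProbability.Build _ _ _ q mT.

Lemma probability_of_measure :
  exists P : probability T R, P = m :> (set T -> \bar R).
Proof. by exists q. Qed.

End probability_of_measure.

(** * Upper bound for the transport cost *)

Lemma transport_cost_le (R : realType) (E : pmetricType R) (p s : R)
    (nu mu : probability (borel E) R) (x0 : E) :
  0 < p -> 1 <= s ->
  (forall A, measurable A -> (nu A <= s%:E * mu A)%E) ->
  (forall A, measurable A -> (mu A <= s%:E * nu A)%E) ->
  (ereal_inf [set \int[pi]_z ((mdist (z : E * E).1 z.2 `^ p)%R)%:E
             | pi in couplings nu mu]
   <= (2 `^ p * (2 * (s - s^-1)))%:E *
      \int[mu]_x ((mdist x0 (x : E) `^ p)%R)%:E)%E.
Proof.
move=> p0 s1 nu_le mu_le; have s0 : 0 < s by exact: lt_le_trans s1.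
have si0 : 0 <= s^-1 by rewrite invr_ge0 ltW.
have si1 : s^-1 <= 1 by rewrite invf_le1.
have c0 : 0 <= s - s^-1 by rewrite subr_ge0 (le_trans si1).
pose k := NngNum si0; pose c := NngNum c0.
have muk A : measurable A -> (mscale k mu A <= nu A)%E.
  by move=> mA; rewrite /mscale/= lee_pdivrMl// mu_le.
have [alpha alphaE'] := measure_sub_exists muk.
have alphaE A : measurable A -> alpha A = (nu A - s^-1%:E * mu A)%E.
  exact: alphaE'.
have fin (m : probability (borel E) R) A : measurable A -> m A \is a fin_num.
  exact: fin_num_measure.
have alphaT : alpha setT = (1 - s^-1)%:E.
  by rewrite alphaE// !probability_setT mule1.
have alpha_le A : measurable A -> (alpha A <= c%:num%:E * mu A)%E.
  move=> mA; rewrite alphaE// EFinB muleBl ?fin//.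
  by rewrite leeB// nu_le.
(* The first coordinate carries [alpha], the second [mu]. What [mu / s] leaves of [mu] is itself a
   multiple of [mu], so this product has the right marginals without normalisation. *)
pose Q := borel_product mu alpha.
have Qfst (A : set (borel E)) : measurable A -> Q (fst @^-1` A) = alpha A.
  move=> mA; rewrite -[RHS]mule1 -(probability_setT mu).
  exact: borel_product_fst.
have Qsnd (A : set (borel E)) : measurable A ->
    Q (snd @^-1` A) = ((1 - s^-1)%:E * mu A)%E.
  by move=> mA; rewrite -alphaT; exact: borel_product_snd.
pose P : {measure set (borel (E * E)%type) -> \bar R} :=
  measure_add (mscale k (distribution mu diag)) Q.
have PE (A : set (borel (E * E)%type)) :
    P A = (s^-1%:E * mu (diag @^-1` A) + Q A)%E.
  exact: measure_addE.
have Pfst (A : set (borel E)) : measurable A -> P (fst @^-1` A) = nu A.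
  move=> mA; rewrite PE Qfst// alphaE// addeC subeK//.
  by rewrite fin_numM// fin.
have Psnd (A : set (borel E)) : measurable A -> P (snd @^-1` A) = mu A.
  move=> mA; rewrite PE Qsnd// -ge0_muleDl ?lee_fin ?subr_ge0//.
  by rewrite -EFinD addrC subrK mul1e.
have PT : P setT = 1%E.
  by rewrite -(preimage_setT fst) Pfst// probability_setT.
have [PP PPE] := probability_of_measure PT.
pose f (x : E) := ((mdist x0 x `^ p)%R)%:E.
have f0 x : (0 <= f x)%E by rewrite lee_fin powR_ge0.
have mf : measurable_fun [set: borel E] f by exact: measurable_mdistr_powR.
pose g (z : E * E) := ((mdist z.1 z.2 `^ p)%R)%:E.
have g0 z : (0 <= g z)%E by rewrite lee_fin powR_ge0.
have mg : measurable_fun [set: borel (E * E)%type] g.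
  exact: measurable_mdist_powR.
apply: (@le_trans _ _ (\int[PP]_z g z)%E).
  apply: ereal_inf_lbound; exists PP => //= A mA.
  by rewrite PPE; split; [exact: Pfst|exact: Psnd].
(* The diagonal part costs nothing, as [d(x, x) = 0]; [p > 0] matters because [0] to the power [0]
   is [1]. *)
have -> : (\int[PP]_z g z = \int[Q]_z g z)%E.
  rewrite PPE /P ge0_integral_measure_add// ge0_integral_mscale//.
  rewrite ge0_integral_distribution//= [X in (_ * X + _)%E]integral0_eq.
    by rewrite mule0 add0e.
  by move=> x _; rewrite /= /g /= mdistxx powR0// gt_eqF.
have mf1 : measurable_fun [set: borel (E * E)%type] (fun z : E * E => f z.1).
  exact: (measurableT_comp mf measurable_fst_borel).
have mf2 : measurable_fun [set: borel (E * E)%type] (fun z : E * E => f z.2).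
  exact: (measurableT_comp mf measurable_snd_borel).
apply: (@le_trans _ _ (\int[Q]_z ((2 `^ p)%:E * (f z.1 + f z.2)))%E).
  apply: ge0_le_integral => //.
  - by apply: measurable_funeM; exact: emeasurable_funD.
  - by move=> z _; rewrite -EFinD -EFinM lee_fin mdist_powR_le// ltW.
rewrite ge0_integralZl//; last 2 first.
- exact: emeasurable_funD.
- by move=> z _; rewrite adde_ge0.
rewrite EFinM -muleA; apply: lee_wpmul2l; first by rewrite lee_fin powR_ge0.
(* The factor [2] splits as [1 + 1], one copy for each marginal of [Q]. *)
rewrite ge0_integralD// EFinM -muleA mulr2n EFinD ge0_muleDl// mul1e.
apply: leeD.
- apply: (ge0_integral_comp_le (c := c) measurable_fst_borel mf f0) => A mA.
  by have := alpha_le A mA; rewrite -Qfst.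
- apply: (ge0_integral_comp_le (c := c) measurable_snd_borel mf f0) => A mA.
  (* The second marginal is only [(1 - 1/s) mu]; since [1 <= s] it is also below the common
     bound. *)
  have : ((1 - s^-1)%:E * mu A <= c%:num%:E * mu A)%E.
    by rewrite lee_wpmul2r// lee_fin lerD2r.
  by rewrite -Qsnd.
Qed.

(** * From the Hilbert metric to domination of measures *)

Lemma hilbert_beta_ge1 d (T : measurableType d) (R : realType)
    (mu nu : probability T R) : (1 <= hilbert_beta mu nu)%E.
Proof.
apply: le_ereal_inf_tmp => _ [r [r0 h] <-]; have := h setT measurableT.
by rewrite !probability_setT mule1 sube_ge0.
Qed.

(** Strictness gives an admissible [r < s] even if the infimum is not attained; [r] is then enlarged
    to [s]. *)
Lemma le_of_hilbert_beta d (T : measurableType d) (R : realType)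
    (mu nu : probability T R) (s : R) : (hilbert_beta mu nu < s%:E)%E ->
  forall A, measurable A -> (nu A <= s%:E * mu A)%E.
Proof.
move=> /ereal_inf_lt[_ [r [r0 rmunu] <-]]; rewrite lte_fin => rs A mA.
apply: (@le_trans _ _ (r%:E * mu A)%E).
  by rewrite -sube_ge0 ?rmunu// fin_num_measure.
by rewrite lee_wpmul2r// lee_fin ltW.
Qed.

(** The logarithm is increasing, so the product of the two factors is below [s]; both are at least
    [1], so each is at most that product. *)
Lemma hilbert_beta_lt d (T : measurableType d) (R : realType)
    (mu nu : probability T R) (s : R) : 1 < s ->
  (hilbert_metric mu nu < (ln s)%:E)%E ->
  (hilbert_beta mu nu < s%:E)%E /\ (hilbert_beta nu mu < s%:E)%E.
Proof.
move=> s1; have s0 : 0 < s by exact: lt_trans s1.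
rewrite -lne_EFin// /hilbert_metric.
have b1 := hilbert_beta_ge1 mu nu; have b2 := hilbert_beta_ge1 nu mu.
have b10 := le_trans lee01 b1; have b20 := le_trans lee01 b2.
rewrite lte_lne ?in_itv/= ?leey ?mule_ge0 ?lee_fin ?(ltW s0)// => bs.
by split; apply: le_lt_trans bs; [rewrite lee_pemulr|rewrite lee_pemull].
Qed.

(** * Convergence in the Wasserstein distance *)

Lemma cvge0_le_eps (R : realType) (u : nat -> \bar R) :
  (forall e : R, 0 < e -> \forall n \near \oo, (0 <= u n <= e%:E)%E) ->
  u n @[n --> \oo] --> (0 : \bar R)%E.
Proof.
move=> ue; apply/fine_cvgP; split.
  (* The case [e = 1] already makes the values eventually finite. *)
  apply: filterS (ue 1 ltr01) => n /andP[u0 u1].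
  by rewrite ge0_fin_numE// (le_lt_trans u1)// ltry.
apply/cvgrPdist_le => e e0; apply: filterS (ue e e0) => n /andP[/=].
case: (u n) => [r| |]//; rewrite !lee_fin sub0r normrN/= => r0 re.
by rewrite ger0_norm.
Qed.

Theorem proposition3p7 (R : realType) (E : pmetricType R) (p : R)
    (mu_ : nat -> probability (borel E) R) (mu : probability (borel E) R) :
  1 <= p ->
  (forall n, finite_moment p (mu_ n)) ->
  hilbert_metric (mu_ n) mu @[n --> \oo] --> (0 : \bar R)%E ->
  wasserstein p (mu_ n) mu @[n --> \oo] --> (0 : \bar R)%E.
Proof.
move=> p1 mom H0; have p0 : 0 < p by exact: lt_le_trans p1.
have near_le s : 1 < s -> \forall n \near \oo,
    (forall A, measurable A -> (mu_ n A <= s%:E * mu A)%E) /\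
    (forall A, measurable A -> (mu A <= s%:E * mu_ n A)%E).
  move=> s1; have : \forall n \near \oo,
      (hilbert_metric (mu_ n) mu < (ln s)%:E)%E.
    apply: (H0 [set y | (y < (ln s)%:E)%E]); apply: open_ereal_lt'.
    by rewrite lte_fin ln_gt0.
  apply: filterS => n /(hilbert_beta_lt s1)[b1 b2].
  by split; apply: le_of_hilbert_beta.
(* The constant [2] is an arbitrary number above [1]. *)
have [N [_ muN]] : exists n, (forall A, measurable A ->
    (mu_ n A <= 2%:E * mu A)%E) /\
    (forall A, measurable A -> (mu A <= 2%:E * mu_ n A)%E).
  have [N _ /(_ N (leqnn N)) NP] := near_le 2 (ltr1n R 2).
  by exists N.
have [x0 momN] := mom N.
pose f (x : E) := ((mdist x0 x `^ p)%R)%:E.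
have f0 x : (0 <= f x)%E by rewrite lee_fin powR_ge0.
have mf : measurable_fun [set: borel E] f by exact: measurable_mdistr_powR.
have K_fin : (\int[mu]_x f x < +oo)%E.
  apply: (@le_lt_trans _ _ (2%:E * \int[mu_ N]_x f x)%E).
    have := @ge0_integral_comp_le _ _ _ _ _ id mu (mu_ N) 2%:nng f.
    by apply.
  by rewrite lte_mul_pinfty.
have K0 : (0 <= \int[mu]_x f x)%E by apply: integral_ge0.
pose K := fine (\int[mu]_x f x).
have KE : (\int[mu]_x f x = K%:E)%E by rewrite fineK// ge0_fin_numE.
have {}K0 : 0 <= K by rewrite fine_ge0.
have W0 n : (0 <= ereal_inf
    [set \int[pi]_z ((mdist (z : E * E).1 z.2 `^ p)%R)%:E
    | pi in couplings (mu_ n) mu])%E.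
  apply: le_ereal_inf_tmp => _ [pi _ <-].
  by apply: integral_ge0 => z _; rewrite lee_fin powR_ge0.
apply: cvge0_le_eps => e e0.
(* For [s = 1 + t] the cost bound is at most [2^p * 4 * t * K], and this [t] brings it below [e^p];
   [K + 1] keeps the denominator positive when [K = 0]. *)
pose t := e `^ p / (2 `^ p * 4 * (K + 1)).
have ep0 : 0 < e `^ p by rewrite powR_gt0.
have D0 : 0 < 2 `^ p * 4 * (K + 1).
  by rewrite !mulr_gt0 ?powR_gt0// ltr_wpDl.
have t0 : 0 < t by rewrite divr_gt0.
have s1 : 1 < 1 + t by rewrite ltrDl.
apply: filterS (near_le _ s1) => n [nu_le mu_le]; rewrite poweR_ge0/=.
(* By monotonicity of the [1/p]-th power, it remains to bound the infimum by [e^p]. *)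
have -> : e%:E = ((e `^ p)%:E `^ p^-1)%E.
  by rewrite poweR_EFin -powRrM divff ?gt_eqF// powRr1// ltW.
apply: gt0_ler_poweR.
- by rewrite invr_ge0 ltW.
- by rewrite in_itv/= W0 leey.
- by rewrite in_itv/= lee_fin powR_ge0 leey.
apply: (le_trans (transport_cost_le x0 p0 (ltW s1) nu_le mu_le)).
rewrite KE -EFinM lee_fin.
(* This comes from [(1 - t) * (1 + t) = 1 - t^2 <= 1]. *)
have st : (1 + t) - (1 + t)^-1 <= 2 * t.
  suff : 2 - (1 + t) <= (1 + t)^-1 by lra.
  rewrite -[leRHS]mul1r ler_pdivlMr ?addr_gt0//; nra.
have tD : t * (2 `^ p * 4 * (K + 1)) = e `^ p by rewrite divfK// gt_eqF.
have p20 : 0 <= 2 `^ p :> R by exact: powR_ge0.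
apply: (@le_trans _ _ (2 `^ p * (2 * (2 * t)) * K)).
  by rewrite ler_wpM2r// ler_wpM2l// ler_wpM2l.
rewrite -tD.
have : 0 <= 2 `^ p * t by rewrite mulr_ge0// ltW.
nra.
Qed.
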